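(* Let $k$ be an integer with $5\leq k\leq 10$ and $k\neq 8$. Then for every integer $m\geq 0$ the polynomial $$\prod_{j=0}^m \left(1+q^{kj+1}\right)\left(1+q^{kj+2}\right)\cdots\left(1+q^{kj+k-1}\right)$$ is unimodal.
   Context: A polynomial $a_0+a_1q+\cdots+a_Nq^N$ (of degree $N$) with integer coefficients is called unimodal if for some $0\leq j\leq N$ one has $a_0\leq a_1\leq\cdots\leq a_j\geq a_{j+1}\geq\cdots\geq a_N$. *)

(* Defs.v *)
From mathcomp Require Import all_boot all_order all_algebra.

Set Implicit Arguments.
Unset Strict Implicit.
Unset Printing Implicit Defensive.

Import Order.TTheory GRing.Theory Num.Theory.
Local Open Scope ring_scope.

(* [(size p).-1] is the degree N of p (when p != 0). *)
Definition unimodal (p : {poly int}) : Prop :=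
  exists j : nat,
    [/\ (j <= (size p).-1)%N,
        forall i : nat, (i < j)%N -> p`_i <= p`_i.+1
      & forall i : nat, (j <= i < (size p).-1)%N -> p`_i.+1 <= p`_i].

(* Main.v *)
(** Let [d(n)] be the coefficient of [q^n] in [(1 - q) P(q)], where [P] is the
    product of the [1 + q^b] over the non-multiples [b <= a] of [k], and let [N]
    be the degree of [P].  As [P] is palindromic, it is unimodal as soon as
    [d(n) >= 0] for [2 n <= N].  Let [a] grow by one.  If [a] is a multiple of
    [k], nothing changes; otherwise [d(n)] becomes [d(n) + d(n - a)], which is
    still nonnegative for [2 n] up to the old degree, so that only the [n] with
    [s = N + 1 - 2 n] in [1, a] (for the new [N]) remain.  For these,
<<
      d(n) = c * int_0^(pi/2) (prod_b cos (b x)) sin (s x) sin x dx,    c > 0.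
>>
    The integrand is nonnegative on [0, pi/(2a)], and the part near [0] alone
    contributes at least a constant times [a^(-9/2)].  On the rest of the
    interval the product of cosines is exponentially small in [a]: by convexity
    it is controlled by the sum of the [cos^2 (b x)] over all [b <= a], which is
    a Dirichlet kernel.  This settles every [a >= 189]; the remaining cases are
    a finite computation. *)
From Stdlib Require Import ZArith Reals Lra Lia.
From Coquelicot Require Import Coquelicot.
Require Import Defs.
From mathcomp Require Import all_boot all_order all_algebra zify ssrZ.

(* MathComp has taken over the key [Z] for its own integers. *)
Delimit Scope Z_scope with BZ.

Fixpoint nonmult (k a : nat) : seq nat :=
  if a is b.+1 then
    if (k %| b.+1)%N then nonmult k b else b.+1 :: nonmult k b
  else [::].

(* [dcoef l n] is the coefficient of [q^n] in [(1 - q) * prod_(a in l) (1 + q^a)],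
   for all integers [n]. *)
Fixpoint dcoef (l : seq nat) (n : Z) : Z :=
  if l is a :: l' then (dcoef l' n + dcoef l' (n - Z.of_nat a))%BZ
  else if (n =? 0)%BZ then 1%BZ else if (n =? 1)%BZ then (-1)%BZ else 0%BZ.

Section CosineProducts.
Local Open Scope R_scope.

(** * The integral representation *)

Definition cosprod (l : seq nat) (x : R) : R :=
  foldr (fun a y => cos (INR a * x) * y) 1 l.

Lemma is_RInt_cos_even (k : Z) :
  is_RInt (fun x => cos (2 * IZR k * x)) 0 (PI / 2)
    (if (k =? 0)%BZ then PI / 2 else 0).
Proof.
case: (Z.eqb_spec k 0) => [->|k0].
  apply: (is_RInt_ext (fun _ => 1)).
    by move=> x _; rewrite Rmult_0_r Rmult_0_l cos_0.
  have := is_RInt_const 0 (PI / 2) (1 : R).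
  by rewrite /Hierarchy.scal /= /Hierarchy.mult /= Rminus_0_r Rmult_1_r.
have k0' : IZR k <> 0 by apply: not_0_IZR.
evar_last.
  apply: (is_RInt_derive (fun x => sin (2 * IZR k * x) / (2 * IZR k))).
    by move=> x _; auto_derive; [|field].
  by move=> x _; apply: ex_derive_continuous; auto_derive.
rewrite /minus /plus /Hierarchy.opp /= Rmult_0_r sin_0.
have -> : 2 * IZR k * (PI / 2) = IZR k * PI by field.
have -> : sin (IZR k * PI) = 0 by apply: sin_eq_0_1; exists k.
by field.
Qed.

(** The recursion of [dcoef] mirrors [2 cos (a x) sin (s x) = sin ((s - a) x) + sin ((s + a) x)];
    for the empty list, [sin ((1 - 2 n) x) sin x] is half a difference of cosines of even multiples
    of [x]. *)
Lemma is_RInt_dcoef (l : seq nat) (n : Z) :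
  is_RInt (fun x => cosprod l x *
      (sin (IZR (Z.of_nat (sumn l) + 1 - 2 * n) * x) * sin x))
    0 (PI / 2) (PI / 4 * IZR (dcoef l n) / 2 ^ size l).
Proof.
elim: l n => [|a l IH] n.
  have H0 := is_RInt_cos_even n; have H1 := is_RInt_cos_even (n - 1).
  have H := is_RInt_scal _ _ _ (/2) _ (is_RInt_minus _ _ _ _ _ _ H0 H1).
  evar_last.
    apply: is_RInt_ext H => x _.
    rewrite /Hierarchy.scal /minus /plus /Hierarchy.opp /=.
    rewrite /Hierarchy.mult /= /Hierarchy.mult /=.
    rewrite minus_IZR Rmult_1_l.
    have -> : IZR (1 - 2 * n) = 1 - 2 * IZR n by rewrite minus_IZR mult_IZR.
    have -> : 2 * IZR n * x = x - ((1 - 2 * IZR n) * x) by ring.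
    have -> : 2 * (IZR n - 1) * x = - (x + ((1 - 2 * IZR n) * x)) by ring.
    by rewrite cos_neg cos_minus cos_plus; field.
  rewrite /Hierarchy.scal /minus /plus /Hierarchy.opp /=.
  rewrite /Hierarchy.mult /= /Hierarchy.mult /=.
  case: (Z.eqb_spec n 0) => [->|n0] /=; first by field.
  case: (Z.eqb_spec (n - 1) 0); case: (Z.eqb_spec n 1) => ? ?; try lia; field.
set s := (Z.of_nat (sumn (a :: l)) + 1 - 2 * n)%BZ.
have es : s = (Z.of_nat a + Z.of_nat (sumn l) + 1 - 2 * n)%BZ.
  by rewrite -Nat2Z.inj_add.
have H := is_RInt_scal _ _ _ (/2) _
  (is_RInt_plus _ _ _ _ _ _ (IH n) (IH (n - Z.of_nat a)%BZ)).
have e1 : (Z.of_nat (sumn l) + 1 - 2 * n = s - Z.of_nat a)%BZ by lia.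
have e2 : (Z.of_nat (sumn l) + 1 - 2 * (n - Z.of_nat a) = s + Z.of_nat a)%BZ.
  by lia.
rewrite e1 e2 in H.
evar_last.
  apply: is_RInt_ext H => x _.
  rewrite /Hierarchy.scal /plus /Hierarchy.mult /= /Hierarchy.mult /=.
  rewrite minus_IZR plus_IZR -INR_IZR_INZ Rmult_minus_distr_r Rmult_plus_distr_r.
  by rewrite sin_minus sin_plus; field.
rewrite /Hierarchy.scal /plus /Hierarchy.mult /= /Hierarchy.mult /= plus_IZR.
field.
by apply: pow_nonzero; lra.
Qed.

(** * Cosine products away from zero *)

Lemma sin_ge_cubic (x : R) : 0 <= x <= 1 -> x - x ^ 3 / 6 <= sin x.
Proof.
move=> x01; have [|H _] := pre_sin_bound x 0 (proj1 x01); first by lra.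
apply: Rle_trans H; apply: Req_le.
by rewrite /sin_approx /sin_term /=; field.
Qed.

Lemma sin_le_x (x : R) : 0 <= x -> sin x <= x.
Proof.
case=> [x0|<-]; last by rewrite sin_0; lra.
exact/Rlt_le/sin_lt_x.
Qed.

Lemma exp_nondecreasing (x y : R) : x <= y -> exp x <= exp y.
Proof. by case=> [/exp_increasing/Rlt_le //|->]; lra. Qed.

Lemma exp_INR_mult (n : nat) (x : R) : exp (INR n * x) = exp x ^ n.
Proof.
elim: n => [|n IH]; first by rewrite Rmult_0_l exp_0.
by rewrite S_INR Rmult_plus_distr_r Rmult_1_l exp_plus IH /= Rmult_comm.
Qed.

Lemma cos_ge_quadratic (x : R) : 1 - x ^ 2 / 2 <= cos x.
Proof.
have H : forall y, 0 <= y -> sin y ^ 2 <= y ^ 2.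
  move=> y y0; have [y1|y1] := Rle_lt_dec y 1; last first.
    have := SIN_bound y; nra.
  have := sin_ge_cubic y (conj y0 y1).
  have := sin_le_x y y0.
  move=> h1 h2; have : 0 <= sin y by nra.
  by nra.
have -> : x = 2 * (x / 2) by field.
rewrite cos_2a_sin.
have : sin (x / 2) ^ 2 <= (x / 2) ^ 2.
  have [x0|x0] := Rle_lt_dec 0 x; first by apply: H; lra.
  have := H (- (x / 2)); rewrite sin_neg; nra.
by nra.
Qed.

Fixpoint sum_cos2 (a : nat) (x : R) : R :=
  if a is b.+1 then cos (INR b.+1 * x) ^ 2 + sum_cos2 b x else 0.

(** Telescoping: [4 sin x cos^2 (b x) = 2 sin x + sin ((2 b + 1) x) - sin ((2 b - 1) x)]. *)
Lemma sum_cos2_closed (a : nat) (x : R) :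
  4 * sin x * sum_cos2 a x =
    2 * INR a * sin x + sin ((2 * INR a + 1) * x) - sin x.
Proof.
elim: a => [|a IH]; first by rewrite /= !(Rmult_0_r, Rplus_0_l, Rmult_1_l); ring.
have -> : sum_cos2 a.+1 x = cos (INR a.+1 * x) ^ 2 + sum_cos2 a x by [].
rewrite Rmult_plus_distr_l IH.
have -> : (2 * INR a + 1) * x = 2 * (INR a.+1 * x) - x by rewrite S_INR; ring.
have -> : (2 * INR a.+1 + 1) * x = 2 * (INR a.+1 * x) + x by ring.
rewrite sin_minus sin_plus cos_2a_cos S_INR; ring.
Qed.

Lemma Dirichlet_kernel_le (a x : R) :
  189 <= a -> PI / (2 * a) <= x <= PI / 2 ->
  sin ((2 * a + 1) * x) <= (3 / 10 * a + 1) * sin x.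
Proof.
move=> a_ge [x_ge x_le]; have pi3 : 3 < PI by have := PI2_3_2; lra.
have pi4 := PI_4.
have ax : PI <= 2 * a * x.
  have -> : PI = 2 * a * (PI / (2 * a)) by field; lra.
  by apply: Rmult_le_compat_l => //; lra.
have x0 : 0 < x by nra.
set u := (2 * a + 1) * x.
have sx0 : 0 < sin x by apply: sin_gt_0; lra.
(* Here [PI <= u], and [sin u <= min 1 (u - 2 PI)] beyond [2 PI]. *)
have [u2|u2] := Rle_lt_dec u (2 * PI).
  have : sin u <= 0 by apply: sin_le_0 => //; rewrite /u; nra.
  by nra.
have sin1 := SIN_bound u.
have [x2|x2] := Rle_lt_dec x (1 / 5); last first.
  have H : sin (1 / 5) <= sin x by apply: sin_incr_1; lra.
  have := sin_ge_cubic (1 / 5) ltac:(lra).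
  by nra.
have H : 993 / 1000 * x <= sin x.
  have := sin_ge_cubic x ltac:(lra).
  have : x ^ 2 <= 1 / 25 by nra.
  by nra.
(* [1489/10000] is just below [3/20 * 993/1000], yet above [1/7], which is enough on both sides of
   [2 PI + 1]. *)
have H2 : 1489 / 10000 * u <= (3 / 10 * a + 1) * sin x.
  apply: (Rle_trans _ ((3 / 10 * a + 1) * (993 / 1000 * x))).
    by rewrite /u; nra.
  by apply: Rmult_le_compat_l => //; lra.
apply: Rle_trans H2.
have [u3|u3] := Rle_lt_dec (2 * PI + 1) u; first by lra.
have -> : u = (u - 2 * PI) + 2 * PI by ring.
rewrite sin_plus cos_2PI sin_2PI.
have := sin_le_x (u - 2 * PI) ltac:(lra).
by lra.
Qed.

(** The [+ 1] of the kernel bound cancels the [- sin x] of the closed form, and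
    [23/40 = (2 + 3/10) / 4]. *)
Lemma sum_cos2_le (a : nat) (x : R) :
  189 <= INR a -> PI / (2 * INR a) <= x <= PI / 2 ->
  sum_cos2 a x <= 23 / 40 * INR a.
Proof.
move=> a_ge hx; have H := Dirichlet_kernel_le _ _ a_ge hx.
have H2 := sum_cos2_closed a x.
have sx0 : 0 < sin x.
  have : 0 < PI / (2 * INR a).
    by apply: Rdiv_lt_0_compat; [exact: PI_RGT_0 | lra].
  by move=> ?; have ? := PI_RGT_0; apply: sin_gt_0; lra.
apply: (Rmult_le_reg_l (4 * sin x)); first by lra.
by lra.
Qed.

Lemma exp_opp_33_ge : 1000 / 1392 <= exp (- (33 / 100)).
Proof.
have -> : - (33 / 100) = INR 100 * - (33 / 10000).
  by rewrite INR_IZR_INZ /=; field.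
rewrite exp_INR_mult.
have H := exp_ineq1_le (- (33 / 10000)).
apply: (Rle_trans _ ((1 + - (33 / 10000)) ^ 100)); last first.
  by apply: pow_incr; lra.
lra.
Qed.

(* Nearly an equality at [x = e^(-0.33)]; applied to each [cos^2], it plays the
   role of the AM-GM inequality. *)
Lemma le_exp_affine (x : R) : 0 <= x -> x <= exp (1392 / 1000 * x - 133 / 100).
Proof.
move=> x0.
have -> : 1392 / 1000 * x - 133 / 100
  = (1392 / 1000 * x - 1) + - (33 / 100) by field.
rewrite exp_plus.
have := exp_ineq1_le (1392 / 1000 * x - 1); have := exp_opp_33_ge.
by nra.
Qed.

(** A multiple of [k] adds only a nonnegative term to the exponent, so the sum may run over all
    [b <= a], where it has a closed form. *)
Lemma cosprod2_le (k a : nat) (x : R) :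
  cosprod (nonmult k a) x ^ 2 <=
    exp (1392 / 1000 * sum_cos2 a x - 133 / 100 * INR (size (nonmult k a))).
Proof.
elim: a => [|a IH]; first by rewrite /= !Rmult_0_r Rminus_0_r exp_0; lra.
rewrite [sum_cos2 _ _]/= [nonmult _ _]/=; set c := cos _.
have c2 : 0 <= c ^ 2 by nra.
case: ifP => _.
  by apply: Rle_trans IH _; apply: exp_nondecreasing; nra.
have -> : cosprod (a.+1 :: nonmult k a) x ^ 2 =
          c ^ 2 * cosprod (nonmult k a) x ^ 2.
  by rewrite /cosprod [foldr _ _ _]/= -/c; ring.
have -> : 1392 / 1000 * (c ^ 2 + sum_cos2 a x)
    - 133 / 100 * INR (size (a.+1 :: nonmult k a)) =
  (1392 / 1000 * c ^ 2 - 133 / 100) +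
  (1392 / 1000 * sum_cos2 a x - 133 / 100 * INR (size (nonmult k a))).
  by rewrite [size _]/= S_INR; ring.
rewrite exp_plus; apply: Rmult_le_compat => //; first by nra.
exact: le_exp_affine.
Qed.

Lemma size_nonmult (k a : nat) : (0 < k)%N -> (size (nonmult k a) + a %/ k = a)%N.
Proof.
move=> k0; elim: a => [|a IH]; first by rewrite div0n.
rewrite /= divnS //; case: ifP => _; first by rewrite addnCA IH.
by rewrite /= add0n addSn IH.
Qed.

Lemma size_nonmult_ge (k a : nat) :
  (5 <= k)%N -> 4 / 5 * INR a <= INR (size (nonmult k a)).
Proof.
move=> k5; have k0 : (0 < k)%N by apply: leq_trans k5.
have e := size_nonmult k a k0.
have h : (a %/ k * 5 <= a)%N.
  by apply: leq_trans (leq_trunc_div a k); rewrite leq_mul2l k5 orbT.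
have : INR (a %/ k * 5) <= INR a by apply/le_INR/leP.
rewrite mult_INR -{2 3}e plus_INR /=; lra.
Qed.

(** The rate is [133/100 * 4/5 - 1392/1000 * 23/40 = 0.2636], rounded down to [9 * 292/10000]; the
    power 9 matches the square of the [a^(-9/2)] gained near 0. *)
Lemma exp_decay_le (a : R) :
  189 <= a -> exp (- (2628 / 10000 * a)) <= / (32 / 25 * a) ^ 9.
Proof.
move=> a_ge.
have -> : - (2628 / 10000 * a) = - (INR 9 * (292 / 10000 * a)).
  by rewrite INR_IZR_INZ /=; field.
rewrite exp_Ropp exp_INR_mult; apply: Rinv_le_contravar.
  by apply: pow_lt; lra.
apply: pow_incr; split; first by lra.
(* Expansion around [a = 189], where the exponent is [5.5188]; three successive tenth powers bound
   its exponential from below. *)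
have -> : 292 / 10000 * a = 292 / 10000 * (a - 189)
    + INR 10 * (INR 10 * (INR 10 * (55188 / 10000000))).
  by rewrite [INR 10]INR_IZR_INZ /=; field.
rewrite exp_plus !exp_INR_mult.
have H1 := exp_ineq1_le (292 / 10000 * (a - 189)).
have H2 : 10055188 / 10000000 <= exp (55188 / 10000000).
  by have := exp_ineq1_le (55188 / 10000000); lra.
have H3 : 105657 / 100000 <= exp (55188 / 10000000) ^ 10.
  apply: (Rle_trans _ ((10055188 / 10000000) ^ 10)); first by lra.
  by apply: pow_incr; lra.
have H4 : 17337 / 10000 <= (exp (55188 / 10000000) ^ 10) ^ 10.
  apply: (Rle_trans _ ((105657 / 100000) ^ 10)); first by lra.
  by apply: pow_incr; lra.
have H5 : 245 <= ((exp (55188 / 10000000) ^ 10) ^ 10) ^ 10.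
  apply: (Rle_trans _ ((17337 / 10000) ^ 10)); first by lra.
  by apply: pow_incr; lra.
move: H1 H5; set X := exp _; set Y := _ ^ 10 => H1 H5.
apply: (Rle_trans _ ((1 + 292 / 10000 * (a - 189)) * 245)); first by lra.
by apply: Rmult_le_compat; lra.
Qed.

Lemma cosprod2_tail (k a : nat) (x : R) :
  (5 <= k)%N -> (189 <= a)%N -> PI / (2 * INR a) <= x <= PI / 2 ->
  cosprod (nonmult k a) x ^ 2 <= / (32 / 25 * INR a) ^ 9.
Proof.
move=> k5 /leP/le_INR; rewrite [INR 189]INR_IZR_INZ /= => a_ge hx.
apply: Rle_trans (exp_decay_le _ a_ge).
apply: Rle_trans (cosprod2_le _ _ _) _; apply: exp_nondecreasing.
have := size_nonmult_ge k a k5; have := sum_cos2_le a x a_ge hx; lra.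
Qed.

(** * Positivity of the integral *)

(** Each [cos y] is at least [1 - y^2 / 2], and a product of numbers in [[0, 1]] is at least 1 minus
    the sum of their defects; the cubic in [a] is [1^2 + ... + a^2]. *)
Lemma cosprod_central (k a : nat) (x : R) :
  0 <= x -> INR a * x <= PI / 2 ->
  0 <= cosprod (nonmult k a) x <= 1 /\
  1 - INR a * (INR a + 1) * (2 * INR a + 1) / 6 * (x ^ 2 / 2)
    <= cosprod (nonmult k a) x.
Proof.
move=> x0; elim: a => [|a IH] ax; first by rewrite /=; lra.
have a0 := pos_INR a.
move: ax; rewrite S_INR => ax.
have [|c01 cge] := IH; first by nra.
rewrite [nonmult _ _]/=; case: ifP => _.
  by split=> //; apply: Rle_trans cge; nra.
have C0 : 0 <= cos ((INR a + 1) * x) by apply: cos_ge_0; have := PI_RGT_0; nra.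
have C1 := COS_bound ((INR a + 1) * x).
have C2 := cos_ge_quadratic ((INR a + 1) * x).
have -> : cosprod (a.+1 :: nonmult k a) x =
          cos ((INR a + 1) * x) * cosprod (nonmult k a) x.
  by rewrite -S_INR.
move: C0 C1 C2 c01 cge; set c := cos _; set p := cosprod _ _.
move=> C0 [_ C1] C2 c01 cge.
split; first by nra.
have H : 1 - (1 - c) - (1 - p) <= c * p by nra.
apply: Rle_trans H.
have -> : 1 - (INR a + 1) * (INR a + 1 + 1) * (2 * (INR a + 1) + 1) / 6
    * (x ^ 2 / 2)
  = 1 - INR a * (INR a + 1) * (2 * INR a + 1) / 6 * (x ^ 2 / 2)
    - ((INR a + 1) * x) ^ 2 / 2 by field.
by lra.
Qed.

Lemma continuous_cosprod (l : seq nat) (x : R) : continuous (cosprod l) x.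
Proof.
elim: l => [|a l IH]; first exact: continuous_const.
apply: (continuous_mult (fun x => cos (INR a * x)) (cosprod l)) => //.
by apply: ex_derive_continuous; auto_derive.
Qed.

Lemma RInt_cosprod_ge0 (k a : nat) (s : R) :
  (5 <= k)%N -> (189 <= a)%N -> 1 <= s <= INR a ->
  0 <= RInt (fun x => cosprod (nonmult k a) x * (sin (s * x) * sin x)) 0 (PI / 2).
Proof.
move=> k5 a189 [s1 sa].
have a_ge : 189 <= INR a.
  by move/leP/le_INR: a189; rewrite [INR 189]INR_IZR_INZ.
set f := fun x => _.
have fint : forall u v, ex_RInt f u v.
  move=> u v; apply: ex_RInt_continuous => x _.
  apply: (continuous_mult (cosprod _) (fun x => sin (s * x) * sin x)).
    exact: continuous_cosprod.
  by apply: ex_derive_continuous; auto_derive.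
have pi3 : 3 < PI by have := PI2_3_2; lra.
have pi4 := PI_4.
set A := INR a in a_ge sa *.
(* [337/1000 A^3] bounds [1^2 + ... + a^2], so the product of cosines is at least
   [1/2] up to [d]. *)
have A3 : 0 < 337 / 1000 * A ^ 3.
  by apply: Rmult_lt_0_compat; [lra | apply: pow_lt; lra].
set d := / sqrt (337 / 1000 * A ^ 3).
have d2 : d ^ 2 * (337 / 1000 * A ^ 3) = 1.
  rewrite /d -{2}(sqrt_sqrt (337 / 1000 * A ^ 3)); last by lra.
  by field; apply: Rgt_not_eq; apply: sqrt_lt_R0.
have d0 : 0 < d by apply/Rinv_0_lt_compat/sqrt_lt_R0.
have Ad : (A * d) ^ 2 <= 1 / 50.
  have : A * (A * d) ^ 2 * (337 / 1000) = 1 by rewrite -d2; ring.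
  by have : 0 <= (A * d) ^ 2 by [nra]; nra.
have Ad1 : A * d <= 1 / 5 by nra.
set b := PI / (2 * A).
have bA : A * b = PI / 2 by rewrite /b; field; lra.
have db : d <= b by nra.
have b2 : b <= PI / 2 by nra.
rewrite -(RInt_Chasles f 0 d) // -(RInt_Chasles f d b) //.
(* The integrand is at least [405/1000 * s * x^2], with [405/1000 = 1/2 * (9/10)^2] from the cosine
   product and the two sines. *)
have main : 135 / 1000 * s * d ^ 3 <= RInt f 0 d.
  have H : is_RInt (fun x => 405 / 1000 * s * x ^ 2) 0 d (135 / 1000 * s * d ^ 3).
    evar_last.
      apply: (is_RInt_derive (fun x => 135 / 1000 * s * x ^ 3)).
        by move=> x _; auto_derive => //; field.
      by move=> x _; apply: ex_derive_continuous; auto_derive.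
    by rewrite /minus /plus /Hierarchy.opp /=; ring.
  rewrite -(is_RInt_unique _ _ _ _ H); apply: RInt_le.
  - by lra.
  - by eexists; exact: H.
  - by [].
  move=> x [x0 xd].
  have Ax : A * x <= 1 / 5 by nra.
  have [_ P] := cosprod_central k a x (Rlt_le _ _ x0) ltac:(rewrite -/A; lra).
  have P2 : 1 / 2 <= cosprod (nonmult k a) x.
    apply: Rle_trans P; rewrite -/A.
    have h1 : A * (A + 1) * (2 * A + 1) / 6 <= 337 / 1000 * A ^ 3 by nra.
    have h2 : x ^ 2 <= d ^ 2 by nra.
    have : A * (A + 1) * (2 * A + 1) / 6 * x ^ 2 <= 1.
      have h0 : 0 <= A * (A + 1) * (2 * A + 1) / 6.
        by do !apply: Rmult_le_pos; lra.
      have := Rmult_le_compat _ _ _ _ h0 (pow2_ge_0 x) h1 h2.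
      by rewrite (Rmult_comm _ (d ^ 2)) d2.
    by lra.
  have S1 : 9 / 10 * x <= sin x.
    by have := sin_ge_cubic x ltac:(nra); have : x ^ 2 <= 1 by [nra]; nra.
  have sx : 0 <= s * x <= 1 / 5 by nra.
  have S2 : 9 / 10 * (s * x) <= sin (s * x).
    have : (s * x) ^ 2 <= 1 / 2 by nra.
    by have := sin_ge_cubic (s * x) ltac:(nra); nra.
  have S3 : 81 / 100 * s * x ^ 2 <= sin (s * x) * sin x.
    have -> : 81 / 100 * s * x ^ 2 = (9 / 10 * (s * x)) * (9 / 10 * x) by field.
    by apply: Rmult_le_compat => //; lra.
  have S0 : 0 <= s * x ^ 2 by nra.
  by rewrite /f; nra.
(* Up to [b] no angle exceeds [PI / 2], as [s <= A], so no factor is negative. *)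
have mid : 0 <= RInt f d b.
  apply: RInt_ge_0 => // x [x1 x2].
  have Ax : A * x <= PI / 2 by nra.
  have [[P _] _] := cosprod_central k a x ltac:(lra) Ax.
  apply: Rmult_le_pos => //; apply: Rmult_le_pos; apply: sin_ge_0; nra.
(* The last interval is shorter than 2, so bounding the integrand by [t] there loses at most [2 t],
   the main contribution at [s = 1]. *)
set t := 135 / 1000 * d ^ 3 / 2.
have t0 : 0 < t by rewrite /t; have := pow_lt d 3 d0; lra.
have tail : - (t * (PI / 2 - b)) <= RInt f b (PI / 2).
  have e : RInt (fun _ => - t) b (PI / 2) = - (t * (PI / 2 - b)).
    rewrite RInt_const /Hierarchy.scal /= /Hierarchy.mult /=; ring.
  rewrite -e.
  apply: RInt_le => //; first exact: ex_RInt_const.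
  move=> x [x1 x2].
  have T := cosprod2_tail k a x k5 a189 ltac:(rewrite -/A -/b; lra).
  (* Both bounds are multiples of [A^(-9)]; [32/25] is large enough for the constants to compare. *)
  have T2 : cosprod (nonmult k a) x ^ 2 <= t ^ 2.
    apply: Rle_trans T _; rewrite -/A.
    have -> : t ^ 2 = (135 / 2000) ^ 2 * (d ^ 2) ^ 3 by rewrite /t; field.
    have -> : d ^ 2 = / (337 / 1000 * A ^ 3).
      by apply: (Rmult_eq_reg_r (337 / 1000 * A ^ 3)); [rewrite d2 Rinv_l |]; lra.
    have -> : / (32 / 25 * A) ^ 9 = / (32 / 25) ^ 9 * / A ^ 9.
      by rewrite -Rinv_mult -Rpow_mult_distr.
    have -> : (135 / 2000) ^ 2 * (/ (337 / 1000 * A ^ 3)) ^ 3 =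
       ((135 / 2000) ^ 2 * / (337 / 1000) ^ 3) * / A ^ 9 by field; lra.
    apply: Rmult_le_compat_r; first by apply/Rlt_le/Rinv_0_lt_compat/pow_lt; lra.
    by lra.
  have P : Rabs (cosprod (nonmult k a) x) <= t.
    by rewrite -(Rabs_pos_eq t); [apply: Rsqr_le_abs_0; rewrite !Rsqr_pow2 | lra].
  have S1 := SIN_bound (s * x); have S2 := SIN_bound x.
  have : Rabs (f x) <= t * 1.
    rewrite /f Rabs_mult; apply: Rmult_le_compat => //; try exact: Rabs_pos.
    by apply: Rabs_le; nra.
  by move/Rabs_le_between; lra.
have : t * (PI / 2 - b) <= t * 2.
  have : 0 < b by nra.
  by move=> ?; apply: Rmult_le_compat_l; lra.
have : 135 / 1000 * d ^ 3 <= 135 / 1000 * s * d ^ 3.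
  by have := pow_lt d 3 d0; nra.
have : t * 2 = 135 / 1000 * d ^ 3 by rewrite /t; field.
by rewrite /plus /=; lra.
Qed.

Lemma dcoef_nonmult_ge0 (k a : nat) (n : Z) :
  (5 <= k)%N -> (189 <= a)%N ->
  (1 <= Z.of_nat (sumn (nonmult k a)) + 1 - 2 * n <= Z.of_nat a)%BZ ->
  (0 <= dcoef (nonmult k a) n)%BZ.
Proof.
move=> k5 a189 [s1 sa]; have H := is_RInt_dcoef (nonmult k a) n.
have := RInt_cosprod_ge0 k a _ k5 a189 (conj (IZR_le _ _ s1) _).
rewrite INR_IZR_INZ => /(_ (IZR_le _ _ sa)).
rewrite (is_RInt_unique _ _ _ _ H) => v; apply: le_IZR.
have P2 : 0 < 2 ^ size (nonmult k a) by apply: pow_lt; lra.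
have pi0 := PI_RGT_0.
apply: (Rmult_le_reg_l (PI / 4 / 2 ^ size (nonmult k a))).
  by apply: Rdiv_lt_0_compat; lra.
rewrite Rmult_0_r; apply: Rle_trans v _; apply: Req_le; field; lra.
Qed.

End CosineProducts.

(** * Antisymmetry and the step from [a] to [a + 1] *)

Definition half_nonneg (l : seq nat) : Prop :=
  forall n : Z, (2 * n <= Z.of_nat (sumn l))%BZ -> (0 <= dcoef l n)%BZ.

Lemma dcoef_neg (l : seq nat) (n : Z) : (n < 0)%BZ -> dcoef l n = 0%BZ.
Proof.
elim: l n => [|a l IH] n n0 /=; last by rewrite !IH; lia.
by case: (Z.eqb_spec n 0); case: (Z.eqb_spec n 1); lia.
Qed.

(** Each [1 + q^a] is palindromic and [1 - q] is antipalindromic. *)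
Lemma dcoef_antisym (l : seq nat) (n : Z) :
  dcoef l (Z.of_nat (sumn l) + 1 - n) = (- dcoef l n)%BZ.
Proof.
elim: l n => [|a l IH] n.
  have [->//|n0] := Z.eq_dec n 0; have [->//|n1] := Z.eq_dec n 1.
  by rewrite /dcoef [sumn _]/= !(proj2 (Z.eqb_neq _ _)) //; lia.
have -> : sumn (a :: l) = (a + sumn l)%N by [].
have e1 : (Z.of_nat (a + sumn l) + 1 - n =
           Z.of_nat (sumn l) + 1 - (n - Z.of_nat a))%BZ by lia.
have e2 : (Z.of_nat (a + sumn l) + 1 - n - Z.of_nat a =
           Z.of_nat (sumn l) + 1 - n)%BZ by lia.
by rewrite [dcoef (a :: l) _]/= e2 e1 !IH /=; lia.
Qed.

Lemma half_nonneg_succ (k a : nat) :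
  (5 <= k)%N -> (188 <= a)%N ->
  half_nonneg (nonmult k a) -> half_nonneg (nonmult k a.+1).
Proof.
move=> k5 a188 H n; have main := @dcoef_nonmult_ge0 k a.+1 n k5 a188.
move: main; rewrite [nonmult k a.+1]/=; case: ifP => _ main; first exact: H.
rewrite -[sumn _]/(a.+1 + sumn (nonmult k a))%N => hn.
(* Up to the old middle both terms are nonnegative by [H]; past it [s <= a + 1], the range covered
   by the integral. *)
have [n_le|n_gt] := Z_le_gt_dec (2 * n) (Z.of_nat (sumn (nonmult k a))).
  by apply: Z.add_nonneg_nonneg; apply: H => //; lia.
by apply: main; rewrite -[sumn _]/(a.+1 + sumn (nonmult k a))%N; lia.
Qed.

(** * The finite verification *)

(** Truncating to the shorter list keeps the length when a shifted copy is added: the computation is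
    modulo a power of [q]. *)
Fixpoint add_seq (u v : seq Z) : seq Z :=
  match u, v with
  | x :: u', y :: v' => (x + y)%BZ :: add_seq u' v'
  | _, _ => [::]
  end.

Definition represents (d : seq Z) (l : seq nat) : Prop :=
  forall i, (i < size d)%N -> nth 0%BZ d i = dcoef l (Z.of_nat i).

Definition check_half (N : nat) (d : seq Z) : bool :=
  (N./2 < size d)%N && all (Z.leb 0) (take N./2.+1 d).

(* [d] holds the first coefficients of [(1 - q) P] for the current [a]; the test
   is made only at the end of each block of [k - 1] factors, since the products
   are not all unimodal in between. *)
Fixpoint sweep (k fuel a N : nat) (d : seq Z) : bool :=
  if fuel is f.+1 then
    let (N', d') := if (k %| a.+1)%N then (N, d)
                    else ((a.+1 + N)%N, add_seq d (ncons a.+1 0%BZ d)) in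
    ((k %| a.+2)%N ==> check_half N' d') && sweep k f a.+1 N' d'
  else true.

Lemma size_add_seq (u v : seq Z) :
  (size u <= size v)%N -> size (add_seq u v) = size u.
Proof. by elim: u v => [|x u IH] [|y v] //= h; rewrite IH. Qed.

Lemma nth_add_seq (u v : seq Z) (i : nat) :
  (size u <= size v)%N -> (i < size u)%N ->
  nth 0%BZ (add_seq u v) i = (nth 0%BZ u i + nth 0%BZ v i)%BZ.
Proof. by elim: u v i => [|x u IH] [|y v] [|i] //= h1 h2; apply: IH. Qed.

Lemma represents_cons (d : seq Z) (l : seq nat) (a : nat) :
  represents d l -> represents (add_seq d (ncons a 0%BZ d)) (a :: l).
Proof.
move=> H i; have h : (size d <= size (ncons a 0%BZ d))%N.
  by rewrite size_ncons leq_addl.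
rewrite size_add_seq // => hi; rewrite nth_add_seq // nth_ncons H //=.
congr (_ + _)%BZ; case: ltnP => ia; first by rewrite dcoef_neg //; lia.
by rewrite H; [congr dcoef; lia | lia].
Qed.

Lemma check_half_sound (d : seq Z) (l : seq nat) :
  represents d l -> check_half (sumn l) d -> half_nonneg l.
Proof.
move=> H /andP[hs /(all_nthP 0%BZ) hall] n hn.
have [n0|n0] := Z_lt_le_dec n 0; first by rewrite dcoef_neg.
have e : n = Z.of_nat (Z.to_nat n) by lia.
have hi : (Z.to_nat n <= (sumn l)./2)%N by lia.
have := hall (Z.to_nat n); rewrite size_takel // nth_take // H; last by lia.
by rewrite -e => /(_ hi) /Z.leb_le.
Qed.

Lemma sweep_sound (k fuel a : nat) (d : seq Z) (b : nat) :
  represents d (nonmult k a) -> sweep k fuel a (sumn (nonmult k a)) d ->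
  (a < b <= a + fuel)%N -> (k %| b.+1)%N -> half_nonneg (nonmult k b).
Proof.
elim: fuel a d => [|f IH] a d H; first by move=> _; lia.
set l' := nonmult k a.+1.
have [d' [H' ->]] : exists d', represents d' l' /\
    sweep k f.+1 a (sumn (nonmult k a)) d =
    ((k %| a.+2)%N ==> check_half (sumn l') d') && sweep k f a.+1 (sumn l') d'.
  rewrite /l' [nonmult k a.+1]/= [sweep k f.+1 _ _ _]/=; case: ifP => _.
    by exists d.
  exists (add_seq d (ncons a.+1 0%BZ d)); split=> //.
  exact: represents_cons.
move=> /andP[chk sw] ab kb; have [e|ne] := eqVneq b a.+1.
  move: chk; rewrite -e kb /= /l' -e in H' * => chk.
  exact: check_half_sound chk.
by apply: (IH a.+1 d') => //; lia.
Qed.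

Definition sweep_all (k fuel len : nat) : bool :=
  sweep k fuel 0 0 [:: 1%BZ, (-1)%BZ & nseq len 0%BZ].

Lemma sweep_all_sound (k fuel len b : nat) :
  sweep_all k fuel len -> (0 < b <= fuel)%N -> (k %| b.+1)%N ->
  half_nonneg (nonmult k b).
Proof.
move=> sw hb; apply: sweep_sound sw hb.
move=> [|[|i]] // _; rewrite [LHS]/= nth_nseq if_same.
by rewrite [nonmult _ _]/= /dcoef !(proj2 (Z.eqb_neq _ _)) //; lia.
Qed.

(* The largest degree that occurs is 16245, for [k = 10] and [a = 189], so that
   8202 coefficients reach past the middle. *)
Lemma sweep_5 : sweep_all 5 189 (82 * 100).
Proof. by vm_cast_no_check (erefl true). Qed.
Lemma sweep_6 : sweep_all 6 191 (82 * 100).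
Proof. by vm_cast_no_check (erefl true). Qed.
Lemma sweep_7 : sweep_all 7 188 (82 * 100).
Proof. by vm_cast_no_check (erefl true). Qed.
Lemma sweep_9 : sweep_all 9 188 (82 * 100).
Proof. by vm_cast_no_check (erefl true). Qed.
Lemma sweep_10 : sweep_all 10 189 (82 * 100).
Proof. by vm_cast_no_check (erefl true). Qed.

(** The sweep tests only block ends, so the induction must start from one; the values of [A] used
    are, for each [k], the first block end at least 188, where [half_nonneg_succ] takes over. *)
Lemma half_nonneg_of_sweep (k A len a : nat) :
  sweep_all k A len -> (5 <= k)%N -> (188 <= A)%N -> (k %| A.+1)%N ->
  (0 < a)%N -> (k %| a.+1)%N -> half_nonneg (nonmult k a).
Proof.
move=> sw k5 A188 kA a0 ka; have [aA|Aa] := leqP a A.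
  by apply: (sweep_all_sound _ _ _ _ sw) => //; rewrite a0.
rewrite -(subnKC (ltnW Aa)); elim: (a - A)%N => [|i IH].
  by rewrite addn0; apply: (sweep_all_sound _ _ _ _ sw) => //; lia.
by rewrite addnS; apply: half_nonneg_succ => //; lia.
Qed.

Lemma half_nonneg_nonmult (k a : nat) :
  (5 <= k <= 10)%N -> k <> 8%N -> (0 < a)%N -> (k %| a.+1)%N ->
  half_nonneg (nonmult k a).
Proof.
move=> hk k8.
have : k \in [:: 5; 6; 7; 9; 10]%N by rewrite !inE; lia.
rewrite !inE => /or4P[/eqP->|/eqP->|/eqP->|/orP[]/eqP->].
- exact: (half_nonneg_of_sweep _ _ _ _ sweep_5 isT isT isT).
- exact: (half_nonneg_of_sweep _ _ _ _ sweep_6 isT isT isT).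
- exact: (half_nonneg_of_sweep _ _ _ _ sweep_7 isT isT isT).
- exact: (half_nonneg_of_sweep _ _ _ _ sweep_9 isT isT isT).
- exact: (half_nonneg_of_sweep _ _ _ _ sweep_10 isT isT isT).
Qed.

(** * Polynomials *)

Import Order.TTheory GRing.Theory Num.Theory.
Local Open Scope ring_scope.

Definition factors_prod (l : seq nat) : {poly int} := \prod_(a <- l) (1 + 'X^a).

Lemma factors_prod_cons (a : nat) (l : seq nat) :
  factors_prod (a :: l) = (1 + 'X^a) * factors_prod l.
Proof. exact: big_cons. Qed.

Lemma Z_of_intD (x y : int) : Z_of_int (x + y) = (Z_of_int x + Z_of_int y)%BZ.
Proof. by lia. Qed.

Lemma coef_dcoef (l : seq nat) (n : nat) :
  Z_of_int ((1 - 'X) * factors_prod l)`_n = dcoef l (Z.of_nat n).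
Proof.
elim: l n => [|a l IH] n.
  rewrite /factors_prod big_nil mulr1 coefB coef1 coefX.
  by case: n => [|[|n]] //; rewrite /dcoef !(proj2 (Z.eqb_neq _ _)) //; lia.
rewrite factors_prod_cons mulrCA mulrDl mul1r coefD coefXnM /= -IH.
case: ltnP => na; first by rewrite addr0 dcoef_neg ?Z.add_0_r //; lia.
have <- : Z.of_nat (n - a) = (Z.of_nat n - Z.of_nat a)%BZ by lia.
by rewrite -IH Z_of_intD.
Qed.

Lemma coefB_dcoef (l : seq nat) (n : nat) :
  Z_of_int ((factors_prod l)`_n.+1 - (factors_prod l)`_n) =
  dcoef l (Z.of_nat n.+1).
Proof. by rewrite -coef_dcoef mulrBl mul1r coefB coefXM. Qed.

Lemma size_factors_prod (l : seq nat) :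
  (sumn l < size (factors_prod l))%N.
Proof.
have mon (a : nat) : (1 + 'X^a : {poly int}) != 0 /\
    (a < size (1 + 'X^a : {poly int})%R)%N.
  have h : (1 + 'X^a : {poly int})`_a != 0.
    (* The coefficient is 2 at [a = 0] and 1 otherwise. *)
    by rewrite coefD coef1 coefXn eqxx; case: (a == 0%N).
  have s : (a < size (1 + 'X^a : {poly int})%R)%N.
    by rewrite ltnNge; apply: contra h => /leq_sizeP ->.
  by split=> //; apply: contraTneq s => ->; rewrite size_poly0.
elim: l => [|a l IH]; first by rewrite /factors_prod big_nil size_poly1.
have [nz s] := mon a.
have nz' : factors_prod l != 0 by apply: contraTneq IH => ->; rewrite size_poly0.
rewrite factors_prod_cons size_mul // -[sumn _]/(a + sumn l)%N.
by move: s IH; set x := size _; set y := size _; lia.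
Qed.

Lemma unimodal_factors_prod (l : seq nat) :
  half_nonneg l -> unimodal (factors_prod l).
Proof.
move=> H; have sz := size_factors_prod l; exists (sumn l)./2.
split=> [|i hi|i /andP[hi _]].
- by lia.
- by have := H (Z.of_nat i.+1); rewrite -coefB_dcoef; lia.
have := coefB_dcoef l i; have := dcoef_antisym l (Z.of_nat i.+1).
(* With [N = sumn l], antisymmetry reflects index [i + 1] to [N - i]. If they coincide, the
   difference is zero; otherwise [N - i] lies in the lower half. *)
have [e|ne] := Z.eq_dec (2 * Z.of_nat i.+1) (Z.of_nat (sumn l) + 1).
  have -> : (Z.of_nat (sumn l) + 1 - Z.of_nat i.+1 = Z.of_nat i.+1)%BZ by lia.
  by lia.
by have := H (Z.of_nat (sumn l) + 1 - Z.of_nat i.+1)%BZ; lia.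
Qed.

Lemma prod_nonmult (k m : nat) : (0 < k)%N ->
  \prod_(0 <= j < m) \prod_(1 <= i < k) (1 + 'X^(k * j + i)) =
  factors_prod (nonmult k (k * m)).
Proof.
move=> k0; elim: m => [|m IH].
  by rewrite big_geq // muln0 /factors_prod big_nil.
(* Induction inside a block, where [k * m + r] with [0 < r < k] is never a multiple of [k]. *)
have step r : (r < k)%N -> factors_prod (nonmult k (k * m + r)) =
    factors_prod (nonmult k (k * m)) * \prod_(1 <= i < r.+1) (1 + 'X^(k * m + i)).
  elim: r => [|r IHr] rk; first by rewrite addn0 big_geq // mulr1.
  rewrite addnS /= -addnS dvdn_addr ?dvdn_mulr // gtnNdvd //.
  rewrite factors_prod_cons IHr ?(ltnW rk) //.
  by rewrite (big_nat_recr r.+1) //= mulrC mulrA.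
rewrite big_nat_recr //= IH.
case: k k0 step {IH} => // k _ step.
have e : (k.+1 * m.+1 = (k.+1 * m + k).+1)%N by rewrite mulnSr addnS.
by rewrite e /= -e dvdn_mulr // step.
Qed.

Theorem corollary1p3 (k : nat) (hk : (5 <= k <= 10)%N) (hk8 : k <> 8%N)
    (m : nat) :
  unimodal (\prod_(0 <= j < m.+1) \prod_(1 <= i < k)
              (1 + 'X^(k * j + i)) : {poly int}).
Proof.
have k0 : (0 < k)%N by lia.
rewrite prod_nonmult //; apply: unimodal_factors_prod.
(* As [k * (m + 1)] is itself a multiple of [k], the list is that of the block end just before
   it. *)
have e : (k * m.+1 = (k * m.+1).-1.+1)%N by rewrite prednK // muln_gt0 k0.
have kd : (k %| (k * m.+1).-1.+1)%N by rewrite -e dvdn_mulr.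
rewrite e /= kd; apply: half_nonneg_nonmult => //.
by have := leq_pmulr k (ltn0Sn m); lia.
Qed.
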